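(* Let $T$ be a tree, let $\lambda: T\to(0,\infty)$ be a weight, and let $\varphi:T\to T$ be an injective self-map such that the composition operator $C_\varphi$ is a compact operator on $L^2_\lambda(T)$. Then $C_\varphi$ is a Hilbert–Schmidt operator on $L^2_\lambda(T)$ if and only if $$\sum_{u\in T}\frac{\lambda(\varphi^{-1}(u))}{\lambda(u)}<\infty.$$ Moreover, in that case, $$\|C_\varphi\|_{S_2}=\Big[\sum_{u\in T}\frac{\lambda(\varphi^{-1}(u))}{\lambda(u)}\Big]^{1/2}.$$
   Context: A tree $T$ is a connected, locally finite graph without cycles on a countably infinite vertex set (identified with $T$), with a fixed vertex $o$ called the root, and with no terminal vertices (a terminal vertex is one having only one neighbour). For a weight $\lambda:T\to(0,\infty)$, $L^2_\lambda(T)$ is the separable Hilbert space of functions $f:T\to\mathbb{C}$ with $\sum_{v\in T}|f(v)|^2\lambda(v)<\infty$, with inner product $\langle f,g\rangle=\sum_{v\in T}f(v)\overline{g(v)}\lambda(v)$. The composition operator is $C_\varphi f(v)=f(\varphi(v))$. For injective $\varphi$ and $u\in T$, $\lambda(\varphi^{-1}(u))$ denotes $\lambda(w)$ if $w$ is the unique vertex with $\varphi(w)=u$, and $0$ if $u\notin\varphi(T)$. For a compact operator $A$ on a separable Hilbert space with singular values $\{\mu_n\}$ and $1\le p<\infty$, $A$ belongs to the Schatten class $S_p$ if $\|A\|_{S_p}=\big[\sum_n|\mu_n|^p\big]^{1/p}<\infty$; Hilbert–Schmidt operators are the elements of $S_2$. *)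

(* Defs.v *)
From HB Require Import structures.
From mathcomp Require Import all_boot all_order all_algebra.
From mathcomp Require Import complex.
From mathcomp Require Import ring lra.
From mathcomp Require Import all_classical all_reals all_analysis.

Set Implicit Arguments.
Unset Strict Implicit.
Unset Printing Implicit Defensive.

Import Order.TTheory GRing.Theory Num.Theory Num.Def.
Import numFieldNormedType.Exports.
Import ComplexField.Normc.

Local Open Scope classical_set_scope.
Local Open Scope complex_scope.
Local Open Scope ring_scope.

Record tree := Tree {
  vertex :> countType ;
  adj : rel vertex ;
  root : vertex ;
  tree_infinite : infinite_set [set: vertex] ;
  adj_sym : symmetric adj ;
  adj_irrefl : irreflexive adj ;
  tree_connected : forall u v, exists2 s, path adj u s & last u s = v ;
  tree_acyclic : forall s, (2 < size s)%N -> ~ ucycle adj s ;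
  tree_locally_finite : forall v, finite_set [set w | adj v w] ;
  tree_no_terminal : forall v, ~ exists w, [set x | adj v x] = [set w] }.

Section unconditional_sums.
Context (R : realType) (T : choiceType).
Implicit Types (a b p q : T -> R) (F G : T -> R[i]).

(* Sum of an absolutely summable real family, as the sum of the positive part
   minus the sum of the negative part. *)
Definition rsum a : R :=
  fine (\esum_(v in setT) (EFin \o a)^\+ v -
        \esum_(v in setT) (EFin \o a)^\- v)%E.

Definition csum F : R[i] :=
  rsum (fun v => complex.Re (F v)) +i* rsum (fun v => complex.Im (F v)).

Definition rsummable a := summable setT (EFin \o a).

Definition csummable F := rsummable (fun v => normc (F v)).

Lemma rsumE p q : (forall v, 0 <= p v) -> (forall v, 0 <= q v) ->
  rsummable p -> rsummable q ->
  rsum (fun v => p v - q v) = fine (\esum_(v in setT) (p v)%:E) -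
                              fine (\esum_(v in setT) (q v)%:E).
Proof.
move=> p0 q0 sp sq; rewrite /rsum.
rewrite (_ : EFin \o _ = (EFin \o p) \- (EFin \o q))%E//.
rewrite esumB//; try by move=> i _ /=; rewrite lee_fin.
rewrite fineB//.
- move: sp; rewrite /rsummable summableE; congr (_ \is a fin_num).
  by apply: eq_esum => i _ /=; rewrite ger0_norm.
- move: sq; rewrite /rsummable summableE; congr (_ \is a fin_num).
  by apply: eq_esum => i _ /=; rewrite ger0_norm.
Qed.

Lemma esumZl a (c : R) : 0 <= c -> (forall v, 0 <= a v) ->
  (\esum_(v in setT) (c * a v)%:E = c%:E * \esum_(v in setT) (a v)%:E)%E.
Proof.
move=> c0 a0; rewrite /esum -ereal_supZl//; last first.
  apply/set0P; exists 0%E; exists set0; first exact: fsets_set0.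
  by rewrite fsbig_set0.
congr ereal_sup; rewrite image_comp; apply: eq_imagel => A [fA _].
by rewrite /= ge0_mule_fsumr// => v; rewrite lee_fin.
Qed.

Lemma le_rsummable a b : (forall v, `|a v| <= b v) -> rsummable b -> rsummable a.
Proof.
move=> ab; apply: le_lt_trans; apply: le_esum => v _ /=; rewrite lee_fin.
exact: le_trans (ab v) (ler_norm _).
Qed.

Lemma rsummableD a b : rsummable a -> rsummable b ->
  rsummable (fun v => a v + b v).
Proof. exact: summableD. Qed.

Lemma rsummableZ c a : rsummable a -> rsummable (fun v => c * a v).
Proof.
rewrite /rsummable /summable => sa.
under eq_esum do rewrite /= normrM; rewrite esumZl//.
by rewrite lte_mul_pinfty// ?lee_fin.
Qed.

Lemma fine_esumD p q : (forall v, 0 <= p v) -> (forall v, 0 <= q v) ->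
  rsummable p -> rsummable q ->
  fine (\esum_(v in setT) (p v + q v)%:E) =
  fine (\esum_(v in setT) (p v)%:E) + fine (\esum_(v in setT) (q v)%:E).
Proof.
move=> p0 q0 sp sq; under eq_esum do rewrite EFinD.
rewrite esumD//; try by move=> i _; rewrite lee_fin.
rewrite fineD//.
- move: sp; rewrite /rsummable summableE; congr (_ \is a fin_num).
  by apply: eq_esum => i _ /=; rewrite ger0_norm.
- move: sq; rewrite /rsummable summableE; congr (_ \is a fin_num).
  by apply: eq_esum => i _ /=; rewrite ger0_norm.
Qed.

Lemma fine_esumZ c p : 0 <= c -> (forall v, 0 <= p v) -> rsummable p ->
  fine (\esum_(v in setT) (c * p v)%:E) = c * fine (\esum_(v in setT) (p v)%:E).
Proof.
move=> c0 p0 sp; rewrite esumZl// fineM//.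
move: sp; rewrite /rsummable summableE; congr (_ \is a fin_num).
by apply: eq_esum => i _ /=; rewrite ger0_norm.
Qed.

Let pos a v := Num.max (a v) 0.
Let neg a v := Num.max (- a v) 0.

Let pos_ge0 a v : 0 <= pos a v. Proof. by rewrite le_max lexx orbT. Qed.
Let neg_ge0 a v : 0 <= neg a v. Proof. by rewrite le_max lexx orbT. Qed.
Let posnegE a v : a v = pos a v - neg a v.
Proof. by rewrite /pos /neg; case: leP => a0; case: leP => b0; lra. Qed.

Let pos_summable a : rsummable a -> rsummable (pos a).
Proof.
move=> sa; apply: (@le_rsummable _ (fun v => `|a v|)).
  move=> v; rewrite ger0_norm// ge_max ler_norm/=; exact: normr_ge0.
by move: sa; rewrite /rsummable /summable; under eq_esum do rewrite /= -normr_id.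
Qed.

Let neg_summable a : rsummable a -> rsummable (neg a).
Proof.
move=> sa; apply: (@le_rsummable _ (fun v => `|a v|)).
  by move=> v; rewrite ger0_norm// ge_max -normrN ler_norm/=; exact: normr_ge0.
by move: sa; rewrite /rsummable /summable; under eq_esum do rewrite /= -normr_id.
Qed.

Lemma rsumD a b : rsummable a -> rsummable b ->
  rsum (fun v => a v + b v) = rsum a + rsum b.
Proof.
move=> sa sb.
have -> : (fun v => a v + b v) =
          (fun v => (pos a v + pos b v) - (neg a v + neg b v)).
  by apply/funext => v; rewrite [in LHS](posnegE a) [in LHS](posnegE b); lra.
have ea : a = (fun v => pos a v - neg a v) by apply/funext => v; exact: posnegE.
have eb : b = (fun v => pos b v - neg b v) by apply/funext => v; exact: posnegE.
have [pa na] := (pos_summable sa, neg_summable sa).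
have [pb nb] := (pos_summable sb, neg_summable sb).
rewrite rsumE ?fine_esumD//; try by [move=> v; exact: addr_ge0
  | exact: rsummableD].
by rewrite [in RHS]ea [in RHS]eb !rsumE//; lra.
Qed.

Lemma rsumN a : rsummable a -> rsum (fun v => - a v) = - rsum a.
Proof.
move=> sa; have [pa na] := (pos_summable sa, neg_summable sa).
have ea : a = (fun v => pos a v - neg a v) by apply/funext => v; exact: posnegE.
have -> : (fun v => - a v) = (fun v => neg a v - pos a v).
  by apply/funext => v; rewrite [in LHS]posnegE opprB.
by rewrite [in RHS]ea !rsumE// opprB.
Qed.

Lemma rsumZ c a : rsummable a -> rsum (fun v => c * a v) = c * rsum a.
Proof.
wlog c0 : c / 0 <= c => [hw sa|sa].
  have [c0|/ltW c0] := leP 0 c; first exact: hw.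
  have := hw (- c); rewrite oppr_ge0 => /(_ c0 sa).
  under eq_fun do rewrite mulNr.
  by rewrite rsumN ?mulNr; [move/oppr_inj|exact: rsummableZ].
have [pa na] := (pos_summable sa, neg_summable sa).
have ea : a = (fun v => pos a v - neg a v) by apply/funext => v; exact: posnegE.
have -> : (fun v => c * a v) = (fun v => c * pos a v - c * neg a v).
  by apply/funext => v; rewrite [in LHS]posnegE mulrBr.
rewrite [in RHS]ea !rsumE//; try by [move=> v; exact: mulr_ge0
  | exact: rsummableZ].
by rewrite !fine_esumZ// mulrBr.
Qed.

Lemma normc_ge0 (z : R[i]) : 0 <= normc z.
Proof. by case: z => x y; exact: sqrtr_ge0. Qed.

Lemma Re_le_normc (z : R[i]) : `|complex.Re z| <= normc z.
Proof. by have := normc_ge_Re z; rewrite lecR. Qed.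

Lemma Im_le_normc (z : R[i]) : `|complex.Im z| <= normc z.
Proof.
by case: z => x y /=; rewrite -sqrtr_sqr ler_wsqrtr// lerDr sqr_ge0.
Qed.

Lemma sqr_normc_ReIm (z : R[i]) :
  normc z ^+ 2 = complex.Re z ^+ 2 + complex.Im z ^+ 2.
Proof. by case: z => x y /=; rewrite sqr_sqrtr// addr_ge0 ?sqr_ge0. Qed.

Lemma csummable_Re F : csummable F -> rsummable (fun v => complex.Re (F v)).
Proof. by apply: le_rsummable => v; exact: Re_le_normc. Qed.

Lemma csummable_Im F : csummable F -> rsummable (fun v => complex.Im (F v)).
Proof. by apply: le_rsummable => v; exact: Im_le_normc. Qed.

Lemma csumD F G : csummable F -> csummable G ->
  csum (fun v => F v + G v) = csum F + csum G.
Proof.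
move=> sF sG; rewrite /csum.
have -> : (fun v => complex.Re (F v + G v)) =
          (fun v => complex.Re (F v) + complex.Re (G v)).
  by apply/funext => v; case: (F v) (G v) => ? ? [].
have -> : (fun v => complex.Im (F v + G v)) =
          (fun v => complex.Im (F v) + complex.Im (G v)).
  by apply/funext => v; case: (F v) (G v) => ? ? [].
have := rsumD (csummable_Re sF) (csummable_Re sG) => /= ->.
by have := rsumD (csummable_Im sF) (csummable_Im sG) => /= ->.
Qed.

Lemma csumZ (c : R[i]) F : csummable F -> csum (fun v => c * F v) = c * csum F.
Proof.
move=> sF; have [sr si] := (csummable_Re sF, csummable_Im sF).
rewrite /csum; case: c => x y.
have -> : (fun v => complex.Re ((x +i* y) * F v)) =
          (fun v => x * complex.Re (F v) + (- y) * complex.Im (F v)).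
  by apply/funext => v; case: (F v) => a b; rewrite mulNr.
have -> : (fun v => complex.Im ((x +i* y) * F v)) =
          (fun v => x * complex.Im (F v) + y * complex.Re (F v)).
  by apply/funext => v; case: (F v) => a b /=.
have -> := rsumD (rsummableZ x sr) (rsummableZ (- y) si).
have -> := rsumD (rsummableZ x si) (rsummableZ y sr).
by rewrite (rsumZ x sr) (rsumZ x si) (rsumZ (- y) si) (rsumZ y sr) mulNr.
Qed.

Lemma csumJ F : csummable F -> csum (fun v => (F v)^*) = (csum F)^*.
Proof.
move=> sF; rewrite /csum /=.
have -> : (fun v => complex.Re (F v)^*) = (fun v => complex.Re (F v)).
  by apply/funext => v; case: (F v).
have -> : (fun v => complex.Im (F v)^*) = (fun v => - complex.Im (F v)).
  by apply/funext => v; case: (F v).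
by rewrite rsumN//; exact: csummable_Im.
Qed.

Lemma csum_real a : (forall v, 0 <= a v) -> rsummable a ->
  csum (fun v => (a v)%:C) = (fine (\esum_(v in setT) (a v)%:E))%:C.
Proof.
move=> a0 sa; rewrite /csum/=.
have s0 : rsummable (fun _ : T => 0 : R).
  by rewrite /rsummable /summable esum1// => v _ /=; rewrite normr0.
have e0 : fine (\esum_(v in [set: T]) (0 : R)%:E) = 0 by rewrite esum1.
have -> : a = (fun v => a v - 0) by apply/funext => v; rewrite subr0.
have -> : rsum (fun _ : T => 0 : R) = 0.
  by rewrite -[X in rsum X](_ : (fun _ : T => 0 - 0) = _) ?rsumE ?subrr//;
    apply/funext => v; rewrite subrr.
rewrite rsumE// e0 subr0; congr (fine _)%:C.
by apply: eq_esum => v _; rewrite subr0.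
Qed.

End unconditional_sums.

Section L2.
Context (R : realType) (T : choiceType) (lam : T -> {posnum R}).
Implicit Types f g : T -> R[i].

Definition square_summable : {pred T -> R[i]} := fun f =>
  `[< \esum_(v in setT) (normc (f v) ^+ 2 * (lam v)%:num)%:E < +oo >]%E.

Record L2 := MkL2 { L2fun :> T -> R[i] ; _ : L2fun \in square_summable }.

HB.instance Definition _ := [isSub for L2fun].
HB.instance Definition _ := [Choice of L2 by <:].

Lemma square_summableP f :
  f \in square_summable <-> rsummable (fun v => normc (f v) ^+ 2 * (lam v)%:num).
Proof.
pose a v := normc (f v) ^+ 2 * (lam v)%:num.
have e : (\esum_(v in setT) (a v)%:E = \esum_(v in setT) `|(a v)%:E|)%E.
  by apply: eq_esum => v _; rewrite gee0_abs// lee_fin mulr_ge0 ?sqr_ge0.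
rewrite unfold_in -/(is_true _); split => [/asboolP|] h; last apply/asboolP.
  by rewrite /rsummable /summable -e.
by rewrite e.
Qed.

Lemma square_summable_submod : submod_closed square_summable.
Proof.
split=> [|c f g].
  apply/square_summableP; rewrite /rsummable /summable esum1// => v _ /=.
  by rewrite !(normc0, expr0n, mul0r, addr0, sqrtr0, normr0).
move=> /square_summableP sf /square_summableP sg; apply/square_summableP.
have := rsummableD (rsummableZ (2 * normc c ^+ 2) sf) (rsummableZ 2 sg).
apply: le_rsummable => v; rewrite ger0_norm; last by rewrite mulr_ge0 ?sqr_ge0.
rewrite !mulrA -mulrDl ler_wpM2r//.
have -> : (c *: f + g) v = c * f v + g v by [].
apply: (@le_trans _ _ ((normc (c * f v) + normc (g v)) ^+ 2)).
  by rewrite ler_pXn2r// ?nnegrE ?addr_ge0 ?normc_ge0//; exact: le_normcD.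
rewrite normcM; have := sqr_ge0 (normc c * normc (f v) - normc (g v)); nra.
Qed.

HB.instance Definition _ :=
  GRing.isSubmodClosed.Build _ _ square_summable square_summable_submod.
HB.instance Definition _ := [SubChoice_isSubLmodule of L2 by <:].

End L2.

Section inner_product_norm.
Context (C : numClosedFieldType) (U : lmodType C) (dot : {dot U for conjC}).

Lemma dot_CauchySchwarz (u v : U) :
  `|dot u v| ^+ 2 <= dot u u * dot v v.
Proof.
have [->|v0] := eqVneq v 0; first by rewrite !linear0r normr0 expr0n/=.
have vv : 0 < dot v v by rewrite dnorm_gt0.
pose a := dot u v / dot v v.
have : 0 <= dot (u - a *: v) (u - a *: v) by exact: dnorm_ge0.
rewrite linearBl /= linearZl_LR /= !linearBr /= !linearZr_LR /=.
have -> : dot v u = (dot u v)^* by rewrite hermC /= expr0 mul1r.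
have vvJ : (dot v v)^* = dot v v by apply/CrealP; exact: gtr0_real.
rewrite {}/a rmorphM /= fmorphV /= vvJ normCK => h.
rewrite -subr_ge0 -(pmulr_rge0 _ vv).
have := h; rewrite -(pmulr_rge0 _ vv) -(pmulr_rge0 _ vv); congr (0 <= _).
rewrite (_ : forall x y : C, x *: (y : C^o) = x * y)//.
by field; rewrite gt_eqF.
Qed.

Lemma dot_triangle (u v : U) :
  sqrtC (dot (u + v) (u + v)) <= sqrtC (dot u u) + sqrtC (dot v v).
Proof.
have ge w : 0 <= dot w w := dnorm_ge0 dot w.
rewrite -ler_sqr ?nnegrE ?addr_ge0 ?sqrtC_ge0//.
rewrite sqrrD !sqrtCK addrAC dnormD lerD2l.
have -> : dot u v + (dot u v)^* = 'Re (dot u v) *+ 2.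
  by rewrite ReE -mulr_natr divfK// pnatr_eq0.
rewrite lerMn2r /=; apply: le_trans (_ : `|dot u v| <= _).
  by have [] := leif_Re_Creal (dot u v).
rewrite -ler_sqr ?nnegrE ?mulr_ge0 ?sqrtC_ge0//.
by rewrite exprMn !sqrtCK; exact: dot_CauchySchwarz.
Qed.

End inner_product_norm.

Section L2_inner_product.
Context (R : realType) (T : choiceType) (lam : T -> {posnum R}).
Implicit Types f g h : L2 lam.

Lemma L2_rsummable f : rsummable (fun v => normc (f v) ^+ 2 * (lam v)%:num).
Proof. by apply/square_summableP; exact: valP f. Qed.

Definition L2dot f g : R[i] :=
  csum (fun v => f v * (g v)^* * ((lam v)%:num)%:C).

Lemma normc_real (x : R) : 0 <= x -> normc x%:C = x.
Proof. by move=> x0; rewrite /= expr0n addr0 sqrtr_sqr ger0_norm. Qed.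

Lemma normc_conj (z : R[i]) : normc (z^*) = normc z.
Proof. by case: z => x y /=; rewrite sqrrN. Qed.

Lemma L2_csummable f g :
  csummable (fun v => f v * (g v)^* * ((lam v)%:num)%:C).
Proof.
have := rsummableD (L2_rsummable f) (L2_rsummable g); apply: le_rsummable => v.
rewrite ger0_norm ?normc_ge0// !normcM normc_real// normc_conj -mulrDl.
rewrite ler_wpM2r//.
have := sqr_ge0 (normc (f v) - normc (g v)).
have := mulr_ge0 (normc_ge0 (f v)) (normc_ge0 (g v)); nra.
Qed.

Lemma L2dotDl f g h : L2dot (f + g) h = L2dot f h + L2dot g h.
Proof.
rewrite /L2dot -(csumD (L2_csummable f h) (L2_csummable g h)).
by congr csum; apply/funext => v; rewrite /= !mulrDl.
Qed.

Lemma L2dotZl c f h : L2dot (c *: f) h = c * L2dot f h.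
Proof.
rewrite /L2dot -(csumZ c (L2_csummable f h)).
by congr csum; apply/funext => v; rewrite /= !mulrA.
Qed.

Lemma L2dotC f g : L2dot f g = (L2dot g f)^*.
Proof.
rewrite /L2dot -(csumJ (L2_csummable g f)); congr csum; apply/funext => v.
have J (x y : R[i]) : (x * y)^* = x^* * y^* by exact: rmorphM.
rewrite !J conjCK [(g v)^* * _]mulrC; congr (_ * _).
by rewrite -[RHS]/(_ -i* _) oppr0.
Qed.

Lemma L2dotDr f g h : L2dot f (g + h) = L2dot f g + L2dot f h.
Proof. by rewrite !(L2dotC f) L2dotDl rmorphD. Qed.

Lemma L2dotZr c f h : L2dot f (c *: h) = c^* * L2dot f h.
Proof. by rewrite !(L2dotC f) L2dotZl rmorphM. Qed.

Let dotBl u' : zmod_morphism (L2dot ^~ u').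
Proof. by move=> f g; rewrite L2dotDl -scaleN1r L2dotZl mulN1r. Qed.

Let dotBr u : zmod_morphism (L2dot u).
Proof.
by move=> f g; rewrite L2dotDr -scaleN1r L2dotZr rmorphN1 mulN1r.
Qed.

Let dotZl u' : scalable_for *%R (L2dot ^~ u').
Proof. by move=> c f; rewrite L2dotZl. Qed.

Let dotZr u : scalable_for (conjC \; *%R) (L2dot u).
Proof. by move=> c f; rewrite L2dotZr. Qed.

HB.instance Definition _ :=
  @isBilinear.Build R[i] (L2 lam) (L2 lam) R[i] *%R (conjC \; *%R) L2dot
    dotBl dotBr dotZl dotZr.

Let dotC f g : L2dot f g = (-1) ^+ false * conjC (L2dot g f).
Proof. by rewrite expr0 mul1r L2dotC. Qed.

HB.instance Definition _ :=
  @isHermitianSesquilinear.Build R[i] (L2 lam) false conjC L2dot dotC.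

Lemma L2dotE f :
  L2dot f f = (fine (\esum_(v in setT) (normc (f v) ^+ 2 * (lam v)%:num)%:E))%:C.
Proof.
rewrite -csum_real; last exact: L2_rsummable.
  by rewrite /L2dot; congr csum; apply/funext => v;
    rewrite -sqr_normc !rmorphM/= expr2.
by move=> v; rewrite mulr_ge0 ?sqr_ge0.
Qed.

Let dot_gt0 f : f != 0 -> 0 < L2dot f f.
Proof.
move=> f0; have [v fv0] : exists v, f v != 0.
  apply: contrapT => /forallNP f0'; move/eqP: f0; apply; apply/val_inj/funext.
  by move=> v; apply/eqP; move: (f0' v) => /negP; rewrite negbK.
rewrite L2dotE ltcR fine_gt0//; apply/andP; split; last first.
  by have := valP f; rewrite unfold_in => /asboolP.
have nf : 0 < normc (f v) ^+ 2 * (lam v)%:num.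
  rewrite mulr_gt0// exprn_gt0// lt_neqAle normc_ge0 andbT eq_sym.
  by apply: contra fv0 => /eqP/eq0_normc ->.
have p0 u : (0 <= (normc (f u) ^+ 2 * (lam u)%:num)%:E)%E.
  by rewrite lee_fin mulr_ge0 ?sqr_ge0.
rewrite (esumID [set v])// setTI esum_set1//.
by rewrite (@lt_le_trans _ _ (normc (f v) ^+ 2 * (lam v)%:num)%:E)%E// leeDl ?esum_ge0.
Qed.

HB.instance Definition _ := @isDotProduct.Build R[i] (L2 lam) L2dot dot_gt0.

Definition L2norm f : R[i] := sqrtC (L2dot f f).

Let L2norm_triangle f g : L2norm (f + g) <= L2norm f + L2norm g.
Proof. exact: (dot_triangle (L2dot : {dot L2 lam for conjC})). Qed.

Let L2normZ (c : R[i]) f : L2norm (c *: f) = `|c| * L2norm f.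
Proof.
rewrite /L2norm; have -> := dnormZ (L2dot : {dot L2 lam for conjC}) c f.
rewrite sqrtCM ?nnegrE ?exprn_ge0//.
by rewrite sqrCK.
Qed.

Let L2norm_eq0 f : L2norm f = 0 -> f = 0.
Proof.
move=> /eqP; rewrite sqrtC_eq0.
by rewrite (dnorm_eq0 (L2dot : {dot L2 lam for conjC})) => /eqP.
Qed.

HB.instance Definition _ :=
  Lmodule_isNormed.Build R[i] (L2 lam) L2norm_triangle L2normZ L2norm_eq0.

End L2_inner_product.

HB.mixin Record isInnerProductSpace (R : realType) H & NormedModule R[i] H := {
  inner : {dot H for @conjC R[i]} ;
  normr_inner : forall x : H, `|x| ^+ 2 = inner x x }.

#[short(type="innerProductSpaceType")]
HB.structure Definition InnerProductSpace (R : realType) :=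
  {H of NormedModule R[i] H & isInnerProductSpace R H}.

Section L2_inner_product_space.
Context (R : realType) (T : choiceType) (lam : T -> {posnum R}).

Let normr_L2dot (f : L2 lam) : `|f| ^+ 2 = L2dot f f.
Proof. exact: sqrtCK. Qed.

HB.instance Definition _ :=
  @isInnerProductSpace.Build R (L2 lam) (@L2dot R T lam) normr_L2dot.

End L2_inner_product_space.

Section schatten.
Context (R : realType) (H : innerProductSpaceType R).
Implicit Types A : {linear H -> H}.

Definition compact_operator A := precompact (A @` [set f | `|f| <= 1]).

Definition is_adjoint A (B : H -> H) :=
  forall f g, inner (A f) g = inner f (B g).

(* On a Hilbert space every bounded operator has exactly one adjoint. *)
Definition adjoint A : H -> H := get [set B | is_adjoint A B].

Definition eigenspace_op (B : H -> H) (a : R[i]) : set H :=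
  [set f | B f = a *: f].

Definition is_basis_of (V : set H) m (e : 'I_m -> H) :=
  (forall i, V (e i)) /\
  (forall f, V f -> exists! c : 'rV[R[i]]_m, f = \sum_i c 0 i *: e i).

Definition has_dim (V : set H) m := exists e : 'I_m -> H, is_basis_of V e.

(* mu lists the singular values of the compact operator A, i.e. the square
   roots of the eigenvalues of A^* A: each t > 0 occurs as often as the
   multiplicity of the eigenvalue t ^ 2.  The order is irrelevant, and 0 may
   occur any number of times, e.g. to pad the list if A has finite rank. *)
Definition is_singular_values A (mu : nat -> R) :=
  (forall n, 0 <= mu n) /\
  (forall t, 0 < t -> exists2 m,
     has_dim (eigenspace_op (adjoint A \o A) (t ^+ 2)%:C) m &
     ([set n | mu n = t] #= `I_m)%card).

Definition singular_values A : nat -> R := get [set mu | is_singular_values A mu].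

Definition schatten_norm (p : R) A : \bar R :=
  ((\sum_(0 <= n <oo) (`|singular_values A n| `^ p)%:E) `^ p^-1)%E.

Definition in_schatten (p : R) A :=
  compact_operator A /\ (schatten_norm p A < +oo)%E.

Definition hilbert_schmidt A := in_schatten 2 A.

End schatten.

Section composition_operator.
Context (R : realType) (T : choiceType) (lam : T -> {posnum R}) (phi : T -> T)
  (phi_L2 : forall f : L2 lam, (f \o phi : T -> R[i]) \in square_summable lam).

Definition composition_operator (f : L2 lam) : L2 lam := MkL2 (phi_L2 f).

Let composition_operator_linear : linear composition_operator.
Proof. by move=> c f g; exact/val_inj. Qed.

HB.instance Definition _ :=
  GRing.isLinear.Build R[i] (L2 lam) (L2 lam) _ composition_operator
    composition_operator_linear.

End composition_operator.

(* lambda (phi^-1 u), for an injective phi *)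
Definition weight_preimage (R : realType) (T : Type) (lam : T -> {posnum R})
    (phi : T -> T) (u : T) : R :=
  if pselect (exists w, phi w = u) is left ex then (lam (projT1 (cid ex)))%:num
  else 0.

(* Main.v *)
Require Import Defs.
From mathcomp Require Import all_boot all_order all_algebra.
From mathcomp Require Import complex finmap.
From mathcomp Require Import all_classical all_reals all_analysis.

(* The adjoint of [C_phi] sends [g] to [u |-> g (phi^-1 u) * r u], where
   [r u := lam (phi^-1 u) / lam u], so that [C_phi^* C_phi] is multiplication
   by [r].  The images under [C_phi] of the normalized point masses at vertices
   with [eps <= r u] are pairwise at distance at least [sqrt eps], so by
   compactness there are finitely many of them; hence [r] is bounded, which makes
   the adjoint well defined, and the eigenspace for [t ^ 2 > 0] is spanned by the
   finitely many point masses at the [u] with [r u = t ^ 2].  The nonzero singular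
   values are thus the [sqrt (r u)], with multiplicity. *)

Set Implicit Arguments.
Unset Strict Implicit.
Unset Printing Implicit Defensive.

Import Order.TTheory GRing.Theory Num.Theory.
Import numFieldNormedType.Exports.
Import ComplexField.Normc.

Local Open Scope classical_set_scope.
Local Open Scope complex_scope.
Local Open Scope ring_scope.

(** * Multiplicities, dimension, and reindexing of sums *)

(** Bijections between the positive level sets glue to a bijection between the supports of [a] and
    [b]. Zeros contribute nothing since [h 0 = 0], so their multiplicities may differ. *)
Lemma esum_eq_card_level (R : realType) (T : choiceType) (a : T -> R)
    (b : nat -> R) (h : R -> R) :
  (forall u, 0 <= a u) -> (forall n, 0 <= b n) -> h 0 = 0 ->
  (forall t, 0 < t -> ([set u | a u = t] #= [set n | b n = t])%card) ->
  (\esum_(u in [set: T]) (h (a u))%:E = \esum_(n in [set: nat]) (h (b n))%:E)%E.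
Proof.
move=> a0 b0 h0 ab.
have supp (I : choiceType) (c : I -> R) : (forall i, 0 <= c i) ->
    (\esum_(i in [set: I]) (h (c i))%:E =
     \esum_(i in [set i | (0 < c i)%R]) (h (c i))%:E)%E.
  move=> c0; rewrite [RHS]esum_mkcond; apply: eq_esum => i _.
  case: ifPn => // /negP ci; congr EFin; rewrite -h0; congr h.
  apply/eqP; rewrite eq_le c0 andbT leNgt; apply/negP => ci0.
  by apply: ci; rewrite inE.
have /choice[g gP] : forall t, exists f : T -> nat, 0 < t ->
    set_bij [set u | a u = t] [set n | b n = t] f.
  move=> t; have [t0|_] := boolP (0 < t); last by exists (fun=> 0%N).
  by have /card_set_bijP[f fP] := ab t t0; exists f.
have bg u : 0 < a u -> b (g (a u) u) = a u.
  by move=> au; have [+ _ _] := gP _ au; exact.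
rewrite supp// [RHS]supp//.
rewrite (@reindex_esum _ _ _ [set u | 0 < a u] _ (fun u => g (a u) u)).
  by apply: eq_esum => u /= /bg ->.
split.
- by move=> u /= au; rewrite bg.
(* Applying [b] recovers the level, so [u] and [v] lie in one level set, where the chosen map is
   injective. *)
- move=> u v; rewrite !inE /= => au av uv.
  have e : a u = a v by rewrite -(bg u)// -(bg v)// uv.
  have [_ + _] := gP _ au; apply; rewrite ?inE//=.
  by rewrite uv e.
- move=> n /= bn; have [_ _ /(_ n erefl)[u /= au un]] := gP _ bn.
  by exists u; rewrite /= au.
Qed.

(** The coordinates of each basis in the other give matrices whose product is 1, by uniqueness of
    coordinates in [e]; the rank then forces [k <= l]. *)
Lemma has_dim_unique (R : realType) (H : innerProductSpaceType R) (V : set H)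
    m n : has_dim V m -> has_dim V n -> m = n.
Proof.
suff le k l : has_dim V k -> has_dim V l -> (k <= l)%N.
  by move=> Vm Vn; apply/eqP; rewrite eqn_leq !le.
move=> [e [Ve eP]] [d [Vd dP]].
have /choice[P PE] : forall i, exists c : 'rV[R[i]]_l,
    e i = \sum_j c 0 j *: d j.
  by move=> i; have [c [cP _]] := dP _ (Ve i); exists c.
have /choice[Q QE] : forall j, exists c : 'rV[R[i]]_k,
    d j = \sum_i c 0 i *: e i.
  by move=> j; have [c [cP _]] := eP _ (Vd j); exists c.
apply: (@mulmx1_min _ _ _ (\matrix_(i, j) P i 0 j) (\matrix_(j, i) Q j 0 i)).
apply/row_matrixP => i; have [c [_ cU]] := eP _ (Ve i).
rewrite -[LHS]cU; first rewrite -[RHS]cU//.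
  rewrite (bigD1 i)//= big1 ?addr0; first by rewrite !mxE eqxx scale1r.
  by move=> j ji; rewrite !mxE eq_sym (negbTE ji) scale0r.
rewrite {1}PE; under eq_bigr do rewrite QE scaler_sumr.
rewrite exchange_big; apply: eq_bigr => j _ /=.
by rewrite !mxE scaler_suml; apply: eq_bigr => x _; rewrite !mxE scalerA.
Qed.

Lemma esum_comp_inj (R : realType) (T : choiceType) (phi : T -> T)
    (a : T -> \bar R) : injective phi ->
  (forall u, ~ (exists w, phi w = u) -> a u = 0%E) ->
  (\esum_(u in [set: T]) a u = \esum_(v in [set: T]) a (phi v))%E.
Proof.
move=> phi_inj a0; rewrite -(esum_image [set: T] phi); last exact: in2W.
rewrite [RHS]esum_mkcond; apply: eq_esum => u _; case: ifPn => // /negP ru.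
by apply: a0 => -[w wu]; apply: ru; rewrite inE; exists w.
Qed.

Lemma csum_comp_inj (R : realType) (T : choiceType) (phi : T -> T)
    (F : T -> R[i]) : injective phi ->
  (forall u, ~ (exists w, phi w = u) -> F u = 0) ->
  csum F = csum (F \o phi).
Proof.
move=> phi_inj F0; rewrite /csum /rsum; congr (_ +i* _); congr (fine (_ - _)%E);
  rewrite (esum_comp_inj phi_inj);
  by [apply: eq_esum => v _; rewrite ?(funeposE, funenegE)
     |move=> u /F0 Fu; rewrite ?(funeposE, funenegE) /= Fu /= ?oppr0 maxxx].
Qed.

(** * Point masses and point evaluations in the weighted space *)

Section L2_point_masses.
Context (R : realType) (T : choiceType) (lam : T -> {posnum R}).
Implicit Types f : L2 lam.

Lemma sqr_normL2 f : `|f| ^+ 2 =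
  (fine (\esum_(v in setT) (normc (f v) ^+ 2 * (lam v)%:num)%:E))%:C.
Proof. by rewrite normr_inner -L2dotE. Qed.

Lemma ge_normL2_point f v :
  (normc (f v) ^+ 2 * (lam v)%:num)%:C <= `|f| ^+ 2.
Proof.
rewrite sqr_normL2 lecR.
have p0 u : (0 <= (normc (f u) ^+ 2 * (lam u)%:num)%:E)%E.
  by rewrite lee_fin mulr_ge0 ?sqr_ge0.
rewrite -lee_fin fineK.
  by rewrite (esumID [set v])// setTI esum_set1// leeDl ?esum_ge0.
rewrite ge0_fin_numE ?esum_ge0//.
by have := valP f; rewrite unfold_in => /asboolP.
Qed.

Lemma esum_point_mass (u : T) :
  (\esum_(v in setT) (normc ((v == u)%:R : R[i]) ^+ 2 * (lam v)%:num)%:E =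
   (lam u)%:num%:E)%E.
Proof.
rewrite -(@esum_set1 _ _ u (fun v => (lam v)%:num%:E)) ?lee_fin//.
rewrite [RHS]esum_mkcond; apply: eq_esum => v _.
have [->|vu] := eqVneq v u.
  by rewrite mem_set//= expr0n addr0 expr1n sqrtr1 expr1n mul1r.
rewrite memNset; last by move=> /= vu'; rewrite vu' eqxx in vu.
by rewrite mulr0n normc0 expr0n mul0r.
Qed.

Lemma point_mass_square_summable (u : T) :
  (fun v => (v == u)%:R : R[i]) \in square_summable lam.
Proof. by apply/asboolP; rewrite esum_point_mass ltry. Qed.

Definition point_mass (u : T) : L2 lam := MkL2 (point_mass_square_summable u).

Lemma sqr_norm_point_mass u : `|point_mass u| ^+ 2 = (lam u)%:num%:C.
Proof. by rewrite sqr_normL2 esum_point_mass. Qed.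

End L2_point_masses.

(** Since [adjoint] is obtained by choice, it must be identified with any explicit adjoint:
    [x := adjoint A g - B g] is orthogonal to itself, as both halves of [inner x x] equal
    [inner (A x) g]. *)
Lemma adjoint_unique (R : realType) (H : innerProductSpaceType R)
    (A : {linear H -> H}) (B : H -> H) : is_adjoint A B -> adjoint A = B.
Proof.
move=> AB; have := @getPex _ [set B | is_adjoint A B] (ex_intro _ B AB).
rewrite -/(adjoint A) /= => AA; apply/funext => g; apply/eqP.
rewrite -subr_eq0 -normr_eq0 -sqrf_eq0 normr_inner linearBr /=.
by rewrite -AB AA subrr.
Qed.

Lemma compact_totally_bounded (K : numFieldType) (V : normedModType K)
    (A : set V) (d : K) : compact A -> 0 < d ->
  exists2 D : set V, finite_set D & forall y, A y -> exists2 x, D x & ball x d y.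
Proof.
move=> Ac d0; move: Ac; rewrite compact_cover => Ac.
have [x _|y Ay|D _ AD] := Ac _ A (fun x => ball x d).
- exact: ball_open.
- by exists y => //; exact: ballxx.
by exists [set` D] => // y /AD[x Dx xy]; exists x.
Qed.

(** * Compactness and the size of the ratio *)

Section composition.
Context (R : realType) (T : choiceType) (lam : T -> {posnum R}) (phi : T -> T).
Context (phi_inj : injective phi).
Context (phi_L2 : forall f : L2 lam,
  (f \o phi : T -> R[i]) \in square_summable lam).

Local Notation Cphi := (composition_operator phi_L2).
Local Notation ratio u := (weight_preimage lam phi u / (lam u)%:num).

Lemma weight_preimage_phi v : weight_preimage lam phi (phi v) = (lam v)%:num.
Proof.
rewrite /weight_preimage; case: pselect => [ex|[]]; last by exists v.
by case: cid => w /= /phi_inj ->.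
Qed.

Lemma weight_preimage_notin u :
  ~ (exists w, phi w = u) -> weight_preimage lam phi u = 0.
Proof. by rewrite /weight_preimage; case: pselect. Qed.

Lemma ratio_ge0 u : 0 <= ratio u.
Proof. by rewrite divr_ge0// /weight_preimage; case: pselect. Qed.

Definition unit_mass u : L2 lam :=
  ((Num.sqrt (lam u)%:num)^-1)%:C *: point_mass lam u.

(** The coordinate at the preimage [w] of [u] suffices: the difference there is [1 / sqrt (lam u)],
    which contributes [lam w / lam u]. Without a preimage the ratio is 0. *)
Lemma separated_unit_masses u v : v != u ->
  (ratio u)%:C <=
  `|Cphi (unit_mass u) - Cphi (unit_mass v)| ^+ 2.
Proof.
move=> vu; have [[w wu]|nu] := pselect (exists w, phi w = u); last first.
  by rewrite weight_preimage_notin// mul0r exprn_ge0.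
apply: le_trans (ge_normL2_point _ w).
have -> : (Cphi (unit_mass u) - Cphi (unit_mass v)) w =
   ((Num.sqrt (lam u)%:num)^-1)%:C.
  transitivity (((Num.sqrt (lam u)%:num)^-1)%:C * (phi w == u)%:R -
    ((Num.sqrt (lam v)%:num)^-1)%:C * (phi w == v)%:R) => //.
  by rewrite wu eqxx eq_sym (negbTE vu) mulr1 mulr0 subr0.
rewrite normc_real ?invr_ge0 ?sqrtr_ge0// exprVn sqr_sqrtr// -wu.
by rewrite weight_preimage_phi mulrC.
Qed.

Lemma norm_unit_mass u : `|unit_mass u| = 1.
Proof.
apply/eqP; rewrite -(@eqrXn2 _ 2)//; apply/eqP.
rewrite /unit_mass normrZ exprMn sqr_norm_point_mass expr1n normc_def /= expr0n addr0.
rewrite sqrtr_sqr ger0_norm ?invr_ge0 ?sqrtr_ge0// -rmorphXn -rmorphM /=.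
by rewrite exprVn sqr_sqrtr// mulVf.
Qed.

Lemma compact_ratio_finite (eps : R) : 0 < eps -> compact_operator Cphi ->
  finite_set [set u | eps <= ratio u].
Proof.
move=> eps0; rewrite /compact_operator precompactE.
set K := closure _ => Kc.
pose e u := Cphi (unit_mass u).
(* Half the separation: two images in one ball of radius [d] are at distance less than [sqrt eps],
   so sending [u] to the centre of a ball containing its image is injective on the set in
   question. *)
pose d : R[i] := (Num.sqrt eps / 2)%:C.
have d0 : 0 < d by rewrite ltcR divr_gt0// sqrtr_gt0.
have [D finD KD] := compact_totally_bounded Kc d0.
have /choice[g gP] : forall u, exists x, D x /\ ball x d (e u).
  move=> u; have [|x xD xu] := KD (e u); last by exists x.
  apply: subset_closure; exists (unit_mass u) => //=.
  by rewrite norm_unit_mass.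
have gI : set_inj [set u | eps <= ratio u] g.
  move=> u v; rewrite !inE/= => ru rv guv.
  apply: contrapT => /eqP; rewrite eq_sym => vu.
  have [_ bu] := gP u; have [_ bv] := gP v; rewrite -guv in bv.
  have : `|e u - e v| < d + d.
    move: bu bv; rewrite -ball_normE /= => bu bv.
    have -> : e u - e v = (g u - e v) - (g u - e u).
      by rewrite opprB [RHS]addrC subrKA.
    by rewrite (le_lt_trans (ler_normB _ _))// ltrD.
  rewrite -(@ltr_pXn2r _ 2)// ?nnegrE ?addr_ge0 ?(ltW d0)// => lt.
  have := le_lt_trans (separated_unit_masses vu) lt.
  rewrite /d -rmorphD /= -rmorphXn /= ltcR => {}lt.
  have := le_lt_trans ru lt.
  by rewrite -splitr sqr_sqrtr ?ltxx// ltW.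
rewrite -(eq_finite_set (inj_card_eq gI)).
by apply: sub_finite_set finD => _ /= [u _ <-]; have [] := gP u.
Qed.

Lemma compact_ratio_bounded : compact_operator Cphi ->
  exists M, forall u, ratio u <= M.
Proof.
move=> /(compact_ratio_finite ltr01)/finite_fsetP[X XE].
have s0 : 0 <= \sum_(x <- X) ratio x.
  by apply: sumr_ge0 => x _; exact: ratio_ge0.
(* Off the finite set [X] the ratio is below 1; on [X] it is a term of the sum. *)
exists (1 + \sum_(x <- X) ratio x) => u.
have [u1|/ltW u1] := leP 1 (ratio u); last by rewrite (le_trans u1)// lerDl.
have uX : u \in X by have : [set` X] u by rewrite -XE.
rewrite (big_rem u)//= addrCA lerDl addr_ge0// sumr_ge0// => x _.
exact: ratio_ge0.
Qed.

(** * The adjoint of the composition operator *)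

(** The candidate adjoint, given on bare functions: that it preserves square summability comes
    later, from the bound on the ratio. *)
Definition weighted_preimage (g : T -> R[i]) (u : T) : R[i] :=
  if pselect (exists w, phi w = u) is left ex
  then g (projT1 (cid ex)) * (ratio u)%:C else 0.

Lemma weighted_preimage_phi g v :
  weighted_preimage g (phi v) = g v * (ratio (phi v))%:C.
Proof.
rewrite /weighted_preimage; case: pselect => [ex|[]]; last by exists v.
by case: cid => w /= /phi_inj ->.
Qed.

Lemma weighted_preimage_notin g u :
  ~ (exists w, phi w = u) -> weighted_preimage g u = 0.
Proof. by rewrite /weighted_preimage; case: pselect. Qed.

(** After reindexing along [phi], the identity [ratio (phi v) * lam (phi v) = lam v] absorbs one of
    the two factors [ratio (phi v)]; [M] bounds the other. *)
Lemma weighted_preimage_square_summable (g : L2 lam) : compact_operator Cphi ->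
  weighted_preimage g \in square_summable lam.
Proof.
move=> /compact_ratio_bounded[M rM]; apply/asboolP.
rewrite (esum_comp_inj phi_inj); last first.
  by move=> u /(weighted_preimage_notin g) ->; rewrite normc0 expr0n mul0r.
have := rsummableZ M (L2_rsummable g); apply: le_lt_trans.
apply: le_esum => v _; rewrite /= lee_fin (le_trans _ (ler_norm _))//.
rewrite weighted_preimage_phi normcM normc_real ?ratio_ge0// exprMn -mulrA.
rewrite mulrCA.
apply: le_trans (_ : normc (g v) ^+ 2 * (ratio (phi v) * (lam v)%:num) <= _).
  rewrite mulrCA ler_wpM2l// ?sqr_ge0// [in leLHS]expr2 -mulrA.
  rewrite ler_wpM2l ?ratio_ge0//.
  by rewrite weight_preimage_phi divfK.
by rewrite mulrCA ler_wpM2r// mulr_ge0 ?sqr_ge0.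
Qed.

Context (Cphi_compact : compact_operator Cphi).

Definition Cphi_adjoint (g : L2 lam) : L2 lam :=
  MkL2 (weighted_preimage_square_summable g Cphi_compact).

Lemma is_adjoint_Cphi : is_adjoint Cphi Cphi_adjoint.
Proof.
move=> f g; change (L2dot (Cphi f) g = L2dot f (Cphi_adjoint g)).
rewrite /L2dot [RHS](csum_comp_inj phi_inj); last first.
  move=> u /(weighted_preimage_notin g) /= ->.
  by rewrite rmorph0 mulr0 mul0r.
congr csum; apply/funext => v /=; rewrite weighted_preimage_phi rmorphM /=.
rewrite -!mulrA; congr (_ * (_ * _)).
rewrite -[(_%:C)^*]/(conjc _) conjc_real -rmorphM /=.
by rewrite weight_preimage_phi divfK.
Qed.

Lemma adjoint_CphiE (f : L2 lam) u :
  adjoint Cphi (Cphi f) u = (ratio u)%:C * f u.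
Proof.
rewrite (adjoint_unique is_adjoint_Cphi) /=.
have [[w <-]|nu] := pselect (exists w, phi w = u).
  by rewrite weighted_preimage_phi mulrC.
by rewrite weighted_preimage_notin// weight_preimage_notin// mul0r mul0r.
Qed.

(** * Eigenspaces of the adjoint composed with the operator *)

(** The point masses at the elements of [X] form a basis, with the values of [f] on [X] as
    coordinates. *)
Lemma has_dim_supported (X : {fset T}) :
  has_dim [set f : L2 lam | forall u, u \notin X -> f u = 0] #|`X|.
Proof.
pose s := tnth (in_tuple (enum_fset X)).
have sX i : s i \in X by exact: mem_tnth.
have sI : injective s by apply/tuple_uniqP; exact: fset_uniq.
have sumE (c : 'rV[R[i]]_#|`X|) (u : T) :
    (\sum_i c 0 i *: point_mass lam (s i)) u = \sum_i c 0 i * (u == s i)%:R.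
  rewrite -[LHS]/(\val (\sum_i c 0 i *: point_mass lam (s i)) u) raddf_sum.
  by rewrite fct_sumE.
have coef (c : 'rV[R[i]]_#|`X|) j :
    (\sum_i c 0 i *: point_mass lam (s i)) (s j) = c 0 j.
  rewrite sumE (bigD1 j)//= eqxx mulr1 big1 ?addr0// => i ij.
  by rewrite (inj_eq sI) eq_sym (negbTE ij) mulr0.
exists (fun i => point_mass lam (s i)); split => [i u uX /=|f f0].
  by rewrite (_ : u == s i = false)//; apply: contraNF uX => /eqP ->.
exists (\row_i f (s i)); split => [|c ->]; last first.
  by apply/rowP => i; rewrite mxE coef.
apply/val_inj/funext => u /=; have [uX|uX] := boolP (u \in X); last first.
  rewrite f0// sumE big1// => i _.
  by rewrite (_ : u == s i = false) ?mulr0//; apply: contraNF uX => /eqP ->.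
have /tnthP[i ->] : u \in in_tuple (enum_fset X) by [].
by rewrite -/s coef mxE.
Qed.

(** The eigenvalue equation reads [(ratio u - t ^+ 2) * f u = 0] at each [u], so the eigenfunctions
    are those supported on the level set [ratio u = t ^+ 2], finite by compactness. *)
Lemma has_dim_eigenspace_Cphi (t : R) : 0 < t ->
  exists2 m, has_dim (eigenspace_op (adjoint Cphi \o Cphi) (t ^+ 2)%:C) m &
    ([set u | Num.sqrt (ratio u) = t] #= `I_m)%card.
Proof.
move=> t0; have t20 : 0 < t ^+ 2 by rewrite exprn_gt0.
have St u : (Num.sqrt (ratio u) = t) <-> (ratio u = t ^+ 2).
  split=> [<-|->]; first by rewrite sqr_sqrtr// ratio_ge0.
  by rewrite sqrtr_sqr gtr0_norm.
have [X XE] : exists X : {fset T}, [set u | Num.sqrt (ratio u) = t] = [set` X].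
  apply/finite_fsetP.
  apply: sub_finite_set (compact_ratio_finite t20 Cphi_compact).
  by move=> u /= /St ->.
exists #|`X|; last by rewrite XE; exact/card_eq_fsetP.
rewrite (_ : eigenspace_op _ _ =
  [set f : L2 lam | forall u, u \notin X -> f u = 0]).
  exact: has_dim_supported.
have XP u : u \in X <-> ratio u = t ^+ 2.
  by rewrite -St; have := congr1 (fun S => S u) XE; rewrite /= => ->.
apply/seteqP; split=> [f fE u uX|f f0].
  have /eqP := congr1 (fun h : L2 lam => h u) fE.
  rewrite /= adjoint_CphiE -[X in _ == X]/((t ^+ 2)%:C * f u) -subr_eq0 -mulrBl.
  rewrite mulf_eq0 subr_eq0 => /orP[/eqP[/XP]|/eqP//].
  by rewrite (negbTE uX).
apply/val_inj/funext => u; rewrite /= adjoint_CphiE.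
rewrite -[RHS]/((t ^+ 2)%:C * f u).
by have [/XP ->//|uX] := boolP (u \in X); rewrite f0// !mulr0.
Qed.

End composition.

(** * Singular values and the Schatten norm *)

Section schatten_norm.
Context (R : realType) (T : countType) (lam : T -> {posnum R}) (phi : T -> T).
Context (phi_inj : injective phi).
Context (phi_L2 : forall f : L2 lam,
  (f \o phi : T -> R[i]) \in square_summable lam).
Local Notation Cphi := (composition_operator phi_L2).
Context (Cphi_compact : compact_operator Cphi).
Local Notation ratio u := (weight_preimage lam phi u / (lam u)%:num).

(** As [singular_values] is obtained by choice, one valid list has to be exhibited. *)
Lemma singular_values_CphiP : is_singular_values Cphi (singular_values Cphi).
Proof.
apply: (@getPex _ [set mu | is_singular_values Cphi mu]).
(* Vertices are listed by their codes. Integers coding no vertex get the padding value 0, which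
   never meets a level [t > 0]. *)
exists (fun n => if pickle_inv n is Some u then Num.sqrt (ratio u) else 0).
split=> [n|t t0]; first by case: pickle_inv.
have [m dm cm] := has_dim_eigenspace_Cphi phi_inj Cphi_compact t0.
exists m => //; apply: card_eq_trans cm.
rewrite (_ : [set n | _] =
    choice.pickle @` [set u | Num.sqrt (ratio u) = t]).
  by apply: inj_card_eq; apply: in2W; exact: pcan_inj (@pickleK_inv T).
apply/seteqP; split=> [n /=|_ [u /= ut <-]]; last by rewrite pickleK_inv.
have := @pickle_invK T n; case: pickle_inv => [u /= <- ut|_ tE].
  by exists u.
by rewrite -tE ltxx in t0.
Qed.

(** The singular values and the family [sqrt (ratio u)] take each [t > 0] equally often, namely as
    often as the dimension of the same eigenspace, so their squares have equal sums. The equality is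
    between extended reals and thus settles both finiteness and value. *)
Lemma schatten_norm_Cphi : schatten_norm 2 Cphi =
  ((\esum_(u in [set: T]) (ratio u)%:E) `^ (1 / 2))%E.
Proof.
rewrite /schatten_norm div1r; congr (_ `^ _)%E.
have [mu0 muP] := singular_values_CphiP.
rewrite nneseries_esumT; last by move=> n; rewrite lee_fin powR_ge0.
have := @esum_eq_card_level R T (fun u => Num.sqrt (ratio u))
  (singular_values Cphi) (fun x => `|x| `^ 2).
rewrite normr0 powR0// => <- //.
  apply: eq_esum => u _; rewrite -[2]/(2%:R) powR_mulrn// ger0_norm//.
  by rewrite sqr_sqrtr// ratio_ge0.
move=> t t0; have [m dm cm] := has_dim_eigenspace_Cphi phi_inj Cphi_compact t0.
have [n dn cn] := muP t t0; apply: card_eq_trans cm _.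
by rewrite (has_dim_unique dm dn) card_eq_sym.
Qed.

End schatten_norm.

Theorem theorem4p5 (R : realType) (T : tree) (lam : T -> {posnum R})
    (phi : T -> T) (phi_inj : injective phi)
    (phi_L2 : forall f : L2 lam,
       (f \o phi : T -> R[i]) \in square_summable lam)
    (Cphi_compact : compact_operator (composition_operator phi_L2)) :
  (hilbert_schmidt (composition_operator phi_L2) <->
     (\esum_(u in [set: T])
        (weight_preimage lam phi u / (lam u)%:num)%:E < +oo)%E) /\
  (hilbert_schmidt (composition_operator phi_L2) ->
     schatten_norm 2 (composition_operator phi_L2) =
       ((\esum_(u in [set: T])
          (weight_preimage lam phi u / (lam u)%:num)%:E) `^ (1 / 2))%E).
Proof.
rewrite /hilbert_schmidt /in_schatten schatten_norm_Cphi//; split=> //.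
(* What remains: a power with exponent 1/2 is finite exactly when its base is. *)
split=> [[_]|h]; last by split=> //; exact: poweR_lty.
by apply: lty_poweRy; rewrite div1r invr_eq0 pnatr_eq0.
Qed.
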